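(* Let $\mathcal{H}=(V,E)$ be a hypergraph with co-rank $s$, $|V|=n$ and adjacency matrix $\mathbf{A}$. Then $$\mathcal{E}(\mathcal{H})\ge\sqrt{\frac{(s-1)^2}{n}Z(\mathcal{H})+n(n-1)|\det(\mathbf{A})|^{2/n}}.$$
   Context: A hypergraph $\mathcal{H}=(V,E)$ consists of a finite vertex set $V$ and a set $E$ of edges, each edge being a subset of $V$ of cardinality at least $2$ (distinct edges are distinct subsets). The co-rank of $\mathcal{H}$ is the smallest cardinality of an edge. For $\alpha\subseteq V$, $d(\alpha)$ is the number of edges containing all vertices of $\alpha$; the degree of $v$ is $d(v)=d(\{v\})$. The Zagreb index is $Z(\mathcal{H})=\sum_{v\in V}d(v)^2$. The adjacency matrix $\mathbf{A}=\mathbf{A}(\mathcal{H})$ is the $n\times n$ matrix with zero diagonal and $(i,j)$ entry $d(\{i,j\})$ for $i\neq j$. The energy is $\mathcal{E}(\mathcal{H})=\sum_{i=1}^n|\lambda_i|$, where $\lambda_1,\dots,\lambda_n$ are the eigenvalues of $\mathbf{A}$. *)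

(* Defs.v *)
From HB Require Import structures.
From mathcomp Require Import all_boot all_order all_algebra.
From mathcomp Require Import complex.
From mathcomp Require Import reals exp.

Set Implicit Arguments.
Unset Strict Implicit.
Unset Printing Implicit Defensive.

Import Order.TTheory GRing.Theory Num.Theory.
Local Open Scope ring_scope.

Record hypergraph (V : finType) := Hypergraph {
  edges : {set {set V}};
  edges_card : forall e : {set V}, e \in edges -> (2 <= #|e|)%N
}.

Section Hypergraph.
Variables (V : finType) (H : hypergraph V).

(* A relation, since a hypergraph without edges has no co-rank. *)
Definition is_corank (s : nat) : Prop :=
  (exists2 e : {set V}, e \in edges H & #|e| = s) /\
  (forall e : {set V}, e \in edges H -> (s <= #|e|)%N).

Definition codegree (a : {set V}) : nat := #|[set e in edges H | a \subset e]|.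

Definition degree (v : V) : nat := codegree [set v].

Definition zagreb : nat := (\sum_(v : V) degree v ^ 2)%N.

(* Rows and columns are indexed by V through the enumeration [enum_val]. *)
Definition adjacency (R : nzRingType) : 'M[R]_#|V| :=
  \matrix_(i, j)
    if i == j then 0 else (codegree [set enum_val i; enum_val j])%:R.

End Hypergraph.

(* The roots of the characteristic polynomial, with multiplicity. *)
Definition eigenvalues (C : closedFieldType) (n : nat) (A : 'M[C]_n) : seq C :=
  sval (closed_field_poly_normal (char_poly A)).

Lemma char_poly_eigenvalues (C : closedFieldType) (n : nat) (A : 'M[C]_n) :
  char_poly A = \prod_(z <- eigenvalues A) ('X - z%:P).
Proof.
rewrite /eigenvalues; case: closed_field_poly_normal => r /= {1}->.
by rewrite (monicP (char_poly_monic A)) scale1r.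
Qed.

(* Eigenvalues are taken in R[i], where the characteristic polynomial splits;
   [Re `|z|] is the modulus of z as an element of R. *)
Definition energy (R : realType) (V : finType) (H : hypergraph V) : R :=
  \sum_(z <- eigenvalues (adjacency H (R[i])%C)) complex.Re `|z|.

(* Main.v *)
Require Import Defs.
From mathcomp Require Import all_boot all_order all_algebra.
From mathcomp Require Import complex.
From mathcomp Require Import reals exp.
From mathcomp Require Import ring.

(* For the eigenvalues l_i, the square of the energy is sum |l_i|^2 plus the
   off-diagonal sum of |l_i| |l_j|. The first part is at least |sum l_i^2|, the
   trace of A^2, hence at least (s-1)^2 Z / n: the row of v sums to at least
   (s-1) d(v), since each edge through v has at least s-1 other vertices, and
   Cauchy-Schwarz applies to each row. In the off-diagonal product each |l_i|
   occurs 2(n-1) times, so AM-GM over the n(n-1) ordered pairs bounds the second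
   part by n(n-1) |det A|^(2/n). *)

Import Order.TTheory GRing.Theory Num.Theory.
Local Open Scope ring_scope.

(** A matrix commutes with itself, so simultaneous trigonalization applies to the family [[:: A]].
    Similar matrices share their characteristic polynomial, and a product of monic linear factors
    determines its roots up to order. *)
Lemma eigenvalues_trig (C : numClosedFieldType) (n : nat) (A : 'M[C]_n) :
  exists P T : 'M[C]_n, [/\ P \in unitmx, A = invmx P *m T *m P &
    perm_eq (eigenvalues A) [seq T i i | i : 'I_n] /\ is_trig_mx T].
Proof.
have [|P Pu] := @cotrigonalization C n [:: A].
  by move=> X Y; rewrite !inE => /eqP -> /eqP ->.
rewrite /= andbT; have uP := unitarymx_unit Pu => PA.
set T := conjmx P A in PA.
have defA : A = invmx P *m T *m P by rewrite -conjVmx// conjmxK.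
exists P, T; split=> //; split=> //.
apply: prod_XsubC_eq; rewrite -char_poly_eigenvalues big_map big_enum /=.
rewrite -char_poly_trig// /char_poly {1}defA.
set p := map_mx polyC P; set q := map_mx polyC (invmx P).
have qp : q *m p = 1%:M by rewrite -map_mxM mulVmx// map_mx1.
(* [q] and [p] are inverse constant matrices over the polynomials, so their determinants cancel. *)
suff -> : char_poly_mx (invmx P *m T *m P) = q *m char_poly_mx T *m p.
  by rewrite !det_mulmx mulrAC -det_mulmx qp det1 mul1r.
rewrite /char_poly_mx mulmxBr mulmxBl !map_mxM.
by rewrite mul_mx_scalar -scalemxAl qp scale_scalar_mx mulr1.
Qed.

(** The difference of the two sides is half of the double sum of [(x i - x j) ^+ 2]. *)
Lemma sqr_sum_le (R : realDomainType) (I : finType) (x : I -> R) :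
  (\sum_i x i) ^+ 2 <= #|I|%:R * \sum_i x i ^+ 2.
Proof.
have: 0 <= \sum_i \sum_j (x i - x j) ^+ 2.
  by apply: sumr_ge0 => i _; apply: sumr_ge0 => j _; apply: sqr_ge0.
suff -> : \sum_i \sum_j (x i - x j) ^+ 2
    = (#|I|%:R * (\sum_i x i ^+ 2) - (\sum_i x i) ^+ 2) *+ 2.
  by rewrite pmulrn_lge0// subr_ge0.
pose S := \sum_i x i; pose Q := \sum_i x i ^+ 2.
rewrite (eq_bigr (fun i => #|I|%:R * x i ^+ 2 + Q - 2 * S * x i)); last first.
  move=> i _; rewrite mulr_natl -[#|I|]/#|xpredT| -sumr_const /Q /S.
  rewrite mulr_sumr mulr_suml -big_split -sumrB.
  by apply: eq_bigr => j _ /=; ring.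
rewrite sumrB big_split /= -!mulr_sumr sumr_const -/S -/Q -mulr_natl.
by ring.
Qed.

Lemma sqr_sum_offdiag (R : comNzRingType) (I : finType) (x : I -> R) :
  (\sum_i x i) ^+ 2 =
    \sum_i x i ^+ 2 + \sum_(p : I * I | p.1 != p.2) x p.1 * x p.2.
Proof.
rewrite expr2 big_distrlr /= pair_bigA /= (bigID (fun p => p.1 == p.2)) /=.
congr (_ + _).
rewrite -(pair_big_dep xpredT (fun i j => i == j) (fun i j => x i * x j)) /=.
by apply: eq_bigr => i _; rewrite (big_pred1 i)// => j; rewrite eq_sym.
Qed.

Lemma card_offdiag (I : finType) :
  #|[pred p : I * I | p.1 != p.2]| = (#|I| * #|I|.-1)%N.
Proof.
rewrite -sum1_card -(pair_big_dep xpredT (fun i j => i != j) (fun _ _ => 1%N)) /=.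
under eq_bigr => i _.
  rewrite sum1_card (eq_card (B := predC1 i)); last by move=> j; rewrite !inE eq_sym.
  rewrite cardC1; over.
by rewrite sum_nat_const.
Qed.

(** Each index is the first coordinate of [#|I|.-1] pairs and the second coordinate of as many; [P1]
    counts the first case, and exchanging the two products reduces the second to it. *)
Lemma prod_offdiag (R : comNzRingType) (I : finType) (x : I -> R) :
  \prod_(p : I * I | p.1 != p.2) (x p.1 * x p.2) = (\prod_i x i) ^+ (2 * #|I|.-1).
Proof.
have P1 (y : I -> R) : \prod_(i : I) \prod_(j : I | i != j) y i = (\prod_i y i) ^+ #|I|.-1.
  rewrite -prodrXl; apply: eq_bigr => i _.
  rewrite prodr_const (eq_card (B := predC1 i)) ?cardC1// => j.
  by rewrite !inE eq_sym.
rewrite -(pair_big_dep xpredT (fun i j => i != j) (fun i j => x i * x j)) /=.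
under eq_bigr do rewrite big_split.
rewrite big_split /= P1 (exchange_big_dep xpredT) //=.
under [X in _ * X]eq_bigr do under eq_bigl do rewrite eq_sym.
by rewrite P1 mul2n -addnn exprD.
Qed.

Lemma le_AGM_offdiag (R : realType) (I : finType) (x : I -> R) :
  (1 < #|I|)%N -> (forall i, 0 <= x i) ->
  #|I|%:R * (#|I|%:R - 1) * (\prod_i x i) `^ (2 / #|I|%:R) <=
    \sum_(p : I * I | p.1 != p.2) x p.1 * x p.2.
Proof.
move=> I1 x0; set n := #|I|; set S := \sum_(p | _) _; set m := (n * n.-1)%N.
have n0 : (0 < n)%N by apply: ltnW.
have m0 : (0 < m)%N by rewrite muln_gt0 n0 -ltnS prednK.
have S0 : 0 <= S by apply: sumr_ge0 => p _; rewrite mulr_ge0.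
have P0 : 0 <= \prod_i x i by apply: prodr_ge0.
have defm : n%:R * (n%:R - 1) = m%:R :> R.
  by rewrite natrM -subn1 natrB.
have AGM : (\prod_i x i) ^+ (2 * n.-1) <= (S / m%:R) ^+ m.
  have := @leif_AGM R _ [pred p : I * I | p.1 != p.2] (fun p => x p.1 * x p.2).
  rewrite card_offdiag => -[|+ _]; first by move=> p _ /=; rewrite mulr_ge0.
  by rewrite -prod_offdiag.
rewrite defm mulrC -ler_pdivlMr ?ltr0n//.
have Sm0 : 0 <= S / m%:R by rewrite divr_ge0.
(* Take the [m]-th root of [AGM]; the exponent becomes [2(n-1) / (n(n-1))], which is [2/n] because
   [n > 1]. *)
have := @ge0_ler_powR R m%:R^-1 _ _ _ _ _ AGM.
rewrite -!powR_mulrn// -!powRrM divff ?powRr1 ?pnatr_eq0 -?lt0n// => le_root.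
suff -> : 2 / n%:R = (2 * n.-1)%:R / m%:R :> R.
  by apply: le_root; rewrite ?invr_ge0// nnegrE powR_ge0.
rewrite /m !natrM; field.
by rewrite !pnatr_eq0 -!lt0n n0 andbT -ltnS prednK.
Qed.

Lemma codegreeE (V : finType) (H : hypergraph V) (a : {set V}) :
  codegree H a = (\sum_(e in edges H) (a \subset e))%N.
Proof.
rewrite /codegree -sum1_card [RHS](bigID (fun e : {set V} => a \subset e)) /=.
rewrite [X in (_ + X)%N]big1 ?addn0; last by move=> e /andP[_ /negbTE->].
rewrite [RHS](eq_bigr (fun=> 1%N)); last by move=> e /andP[_ ->].
by apply: eq_bigl => e; rewrite inE.
Qed.

Lemma degree_le_codegree (V : finType) (H : hypergraph V) (s : nat) (v : V) :
  is_corank H s ->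
  (s.-1 * degree H v <= \sum_(u | v != u) codegree H [set v; u])%N.
Proof.
move=> [_ sH]; rewrite /degree codegreeE big_distrr /=.
under [leqRHS]eq_bigr do rewrite codegreeE.
(* Compare edge by edge: an edge avoiding [v] adds 0 on the left, and an edge through [v] adds its
   number of other vertices on the right. *)
rewrite exchange_big /=; apply: leq_sum => e eH.
rewrite sub1set; have [ve|] := boolP (v \in e); last by rewrite muln0.
under eq_bigr => u _ do rewrite subUset !sub1set ve /=.
rewrite muln1 -subn1 leq_subLR (leq_trans (sH e eH))// (cardsD1 v) ve leq_add2l.
rewrite -sum1_card big_mkcond [leqRHS]big_mkcond /=; apply: leq_sum => u _.
by rewrite !inE eq_sym; case: eqP; case: (u \in e).
Qed.

Lemma corank_zagreb_le (R : realDomainType) (V : finType) (H : hypergraph V) (s : nat) :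
  is_corank H s ->
  (s%:R - 1) ^+ 2 * (zagreb H)%:R <=
     #|V|%:R * (\sum_v \sum_(u | v != u) codegree H [set v; u] ^ 2)%:R :> R.
Proof.
move=> Hs; rewrite /zagreb !natr_sum !mulr_sumr; apply: ler_sum => v _.
(* Positivity of [s] makes the truncated [s.-1] agree with [s - 1] in the ring. *)
have s0 : (0 < s)%N.
  by case: Hs => [[e /edges_card e2 <-] _]; apply: leq_trans e2.
have -> : s%:R - 1 = s.-1%:R :> R by rewrite -subn1 natrB.
rewrite natrX -exprMn -(natrM _ s.-1) big_mkcond /=.
(* Extending the row by 0 at [v] lets Cauchy-Schwarz run over all of [V], whence the factor
   [#|V|]. *)
pose x u := if v != u then codegree H [set v; u] else 0%N.
apply: (@le_trans _ _ ((\sum_u (x u)%:R) ^+ 2)).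
  rewrite -natr_sum ler_sqr ?nnegrE ?ler0n// ler_nat -big_mkcond.
  exact: degree_le_codegree.
apply: le_trans (sqr_sum_le _ _ (fun u => (x u)%:R)) _.
rewrite natr_sum ler_wpM2l//; apply: ler_sum => u _.
by rewrite -natrX /x; case: ifP.
Qed.

Lemma size_eigenvalues (C : closedFieldType) (n : nat) (A : 'M[C]_n) :
  size (eigenvalues A) = n.
Proof.
apply: succn_inj; rewrite -(size_char_poly A) char_poly_eigenvalues.
by rewrite size_prod_XsubC.
Qed.

Lemma prod_eigenvalues (C : closedFieldType) (n : nat) (A : 'M[C]_n) :
  \prod_(z <- eigenvalues A) z = \det A.
Proof.
have := char_poly_det A; rewrite char_poly_eigenvalues -horner_coef0 horner_prod.
under eq_bigr do rewrite hornerXsubC sub0r -mulN1r.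
rewrite big_split /= big_const_seq count_predT size_eigenvalues iter_mulr_1.
by apply/mulfI; rewrite signr_eq0.
Qed.

Lemma sum_eigenvalues_sqr (C : numClosedFieldType) (n : nat) (A : 'M[C]_n) :
  \sum_(z <- eigenvalues A) z ^+ 2 = \tr (A *m A).
Proof.
have [P [T [Pu defA [eigT trigT]]]] := eigenvalues_trig C n A.
rewrite (perm_big _ eigT) big_map big_enum /=.
have -> : \tr (A *m A) = \tr (T *m T).
  by rewrite defA !mulmxA mulmxK// -!mulmxA mxtrace_mulC -!mulmxA mulmxV// mulmx1.
apply: eq_bigr => i _; rewrite mxE (bigD1 i)//= big1 ?addr0// => j ji.
(* For [j] distinct from [i], one of [T i j] and [T j i] lies above the diagonal of the lower
   triangular [T], so their product vanishes. *)
have [ij|ji'] := ltnP i j; first by rewrite (is_trig_mxP trigT)// mul0r.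
rewrite (is_trig_mxP trigT j i) ?mulr0// ltn_neqAle ji'.
by rewrite andbT.
Qed.

(** Relates the determinant over [R] in the bound to the one over [R[i]], where the eigenvalues
    live. *)
Lemma adjacency_map (R S : nzRingType) (f : {rmorphism R -> S}) (V : finType)
    (H : hypergraph V) :
  adjacency H S = map_mx f (adjacency H R).
Proof.
by apply/matrixP => i j; rewrite !mxE; case: eqP; rewrite ?rmorph0 ?rmorph_nat.
Qed.

Lemma tr_adjacency_sqr (R : nzRingType) (V : finType) (H : hypergraph V) :
  \tr (adjacency H R *m adjacency H R) =
    (\sum_v \sum_(u | v != u) codegree H [set v; u] ^ 2)%:R.
Proof.
rewrite natr_sum (reindex _ (onW_bij _ (enum_val_bij V))); apply: eq_bigr => i _.
rewrite mxE (reindex _ (onW_bij _ (enum_val_bij V))) natr_sum [RHS]big_mkcond.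
apply: eq_bigr => j _ /=.
rewrite !mxE (inj_eq enum_val_inj) [j == i]eq_sym setUC.
by case: eqP => _; rewrite ?mul0r// natrX expr2 [X in _ * (codegree _ X)%:R]setUC.
Qed.

Theorem theorem32 (R : realType) (V : finType) (H : hypergraph V) (s : nat)
    (hs : is_corank H s) :
  energy R H >=
    Num.sqrt ((s%:R - 1) ^+ 2 / #|V|%:R * (zagreb H)%:R
              + #|V|%:R * (#|V|%:R - 1)
                * `|\det (adjacency H R)| `^ (2 / #|V|%:R)).
Proof.
(* The co-rank is attained by some edge, which has at least two vertices. *)
have n1 : (1 < #|V|)%N.
  have [[e /edges_card e2 _] _] := hs.
  exact: leq_trans e2 (max_card _).
have nR : 0 < #|V|%:R :> R by rewrite ltr0n ltnW.
set n := #|V| in n1 nR *.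
pose A := adjacency H R[i]; pose x (i : 'I_n) : R := complex.Re `|(eigenvalues A)`_i|.
have xE i : (x i)%:C%C = `|(eigenvalues A)`_i|.
  by rewrite RRe_real// normr_real.
have x0 i : 0 <= x i by rewrite -lecR xE normr_ge0.
have EE : energy R H = \sum_i x i.
  by rewrite /energy (big_nth 0) size_eigenvalues big_mkord.
have prodx : \prod_i x i = `|\det (adjacency H R)|.
  apply: complexI; rewrite rmorph_prod /=; under eq_bigr do rewrite xE.
  rewrite -normr_prod.
  transitivity `|\prod_(z <- eigenvalues A) z|.
    by rewrite (big_nth 0) size_eigenvalues big_mkord.
  rewrite prod_eigenvalues /A (adjacency_map R _ (real_complex R)) det_map_mx.
  by rewrite normc_def /= expr0n addr0 sqrtr_sqr.
pose Q : nat := (\sum_v \sum_(u | v != u) codegree H [set v; u] ^ 2)%N.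
have leQ : Q%:R <= \sum_i x i ^+ 2.
  rewrite -lecR.
  have -> : (\sum_i x i ^+ 2)%:C%C = \sum_(i < n) `|(eigenvalues A)`_i ^+ 2|.
    by rewrite rmorph_sum; apply: eq_bigr => i _; rewrite normrX -xE; exact: rmorphXn.
  rewrite -(big_mkord xpredT (fun i => `|(eigenvalues A)`_i ^+ 2|)).
  rewrite -(size_eigenvalues _ n A) -(big_nth 0 xpredT (fun z => `|z ^+ 2|)).
  (* By the triangle inequality it suffices to bound the norm of the sum of squares, which is the
     trace [Q], a natural number equal to its own norm. *)
  apply: le_trans (ler_norm_sum _ _ _).
  by rewrite sum_eigenvalues_sqr tr_adjacency_sqr normr_nat rmorph_nat.
have E0 : 0 <= energy R H by rewrite EE sumr_ge0.
suff le_sqr : (s%:R - 1) ^+ 2 / n%:R * (zagreb H)%:R +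
    n%:R * (n%:R - 1) * `|\det (adjacency H R)| `^ (2 / n%:R) <= energy R H ^+ 2.
  by apply: le_trans (ler_wsqrtr le_sqr) _; rewrite sqrtr_sqr ger0_norm.
rewrite EE sqr_sum_offdiag lerD//.
  apply: le_trans leQ; rewrite mulrAC ler_pdivrMr//.
  by rewrite [leRHS]mulrC; apply: corank_zagreb_le.
rewrite -prodx; have := le_AGM_offdiag R _ x; rewrite card_ord; exact.
Qed.
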